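(* Let $X$ be a normed space, let $T:X\to X$ be linear and non-expansive, and let $x^*\in\operatorname{Fix}(T)$. Let $\beta=(\beta_n)_{n\ge0}$ be a sequence in $[0,1]$ with $\beta_0=0$, and for $n\ge1$ let $\Theta_n:[0,1]^n\to\mathbb{R}$ be defined by $$\Theta_n(\beta)=1-\beta_n+\Pi_1^n(\beta)+\sum_{k=1}^n\left|(2-\beta_{k-1})\beta_k-1\right|\,\Pi_{k+1}^n(\beta).$$ Then the Halpern iterates $x^n=(1-\beta_n)y^0+\beta_nTx^{n-1}$ ($n\ge1$) with initial data $x^0=y^0\in X$ satisfy $$\|x^n-Tx^n\|\le\|x^0-x^*\|\,\Theta_n(\beta).$$ Moreover, this bound is tight: for the right-shift operator $T:\ell^1(\mathbb{N})\to\ell^1(\mathbb{N})$, $T(x_0,x_1,x_2,\ldots)=(0,x_0,x_1,x_2,\ldots)$, the iterates started from $x^0=y^0=(1,0,0,\ldots)$ satisfy this inequality with equality.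
   Context: $\Pi_k^n(\beta)=\prod_{l=k}^n\beta_l$, with the convention that the product equals $1$ for $k>n$. $\Theta_n(\beta)$ is viewed as a function of $(\beta_1,\ldots,\beta_n)\in[0,1]^n$, with $\beta_0=0$ fixed. $\operatorname{Fix}(T)$ is the set of fixed points of $T$ (for the right-shift, only $x^*=0$). Non-expansive means $\|Tx-Ty\|\le\|x-y\|$ for all $x,y\in X$. *)

(* Defs.v *)
From HB Require Import structures.
From mathcomp Require Import all_boot all_order all_algebra.
From mathcomp Require Import all_classical all_reals all_analysis.
Import Order.TTheory GRing.Theory Num.Theory numFieldNormedType.Exports.

Set Implicit Arguments.
Unset Strict Implicit.
Unset Printing Implicit Defensive.

Local Open Scope classical_set_scope.
Local Open Scope ring_scope.

Section Halpern.
Context {R : realType}.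

Definition Pi (beta : nat -> R) (k n : nat) : R :=
  \prod_(k <= l < n.+1) beta l.

(* Only beta 0, ..., beta n occur. The value beta 0, which is read at k = 1, is
   fixed to 0 by hypothesis wherever Theta is used. *)
Definition Theta (n : nat) (beta : nat -> R) : R :=
  1 - beta n + Pi beta 1 n
  + \sum_(1 <= k < n.+1) `|(2 - beta k.-1) * beta k - 1| * Pi beta k.+1 n.

Definition Fix {X : Type} (T : X -> X) : set X := [set x | T x = x].

Definition nonexpansive {X : normedModType R} (T : X -> X) : Prop :=
  forall x y, `|T x - T y| <= `|x - y|.

Fixpoint halpern {X : lmodType R} (T : X -> X) (beta : nat -> R) (y0 : X)
    (n : nat) : X :=
  if n is m.+1 then (1 - beta n) *: y0 + beta n *: T (halpern T beta y0 m)
  else y0.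

End Halpern.

(* The library has L^1 of a measure only as a semi-normed module of functions
   or as a bare quotient type, so l^1(N) is built here as a normedModType. *)
Section Ell1.
Variable R : realType.
Implicit Types x y : nat -> R.

Definition ell1_pred : {pred nat -> R} :=
  mem [set x : nat -> R | cvgn [normed series x]].

Lemma ell1_predP x : reflect (cvgn [normed series x]) (x \in ell1_pred).
Proof. exact: asboolP. Qed.

Record ell1 := Ell1 { ell1_val :> nat -> R; ell1_valP : ell1_val \in ell1_pred }.

HB.instance Definition _ := [isSub for ell1_val].
HB.instance Definition _ := [Choice of ell1 by <:].

Lemma normed_seriesE x n : [normed series x] n = \sum_(0 <= k < n) `|x k|.
Proof. by []. Qed.

Lemma cvg_normed0 : cvgn [normed series (0 : nat -> R)].
Proof.
apply: (@cvgP _ _ 0); rewrite (_ : [normed series _] = cst 0).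
  exact: cvg_cst.
by apply/funext => n; rewrite normed_seriesE big1// => i _; rewrite normr0.
Qed.

Lemma cvg_normedD x y : cvgn [normed series x] -> cvgn [normed series y] ->
  cvgn [normed series (x + y)].
Proof.
move=> cx cy; apply: (@series_le_cvg _ _ (fun k => `|x k| + `|y k|)) => //=.
- by move=> k; exact: ler_normD.
- exact: (is_cvg_seriesD cx cy).
Qed.

Lemma normed_seriesZ (a : R) x :
  [normed series (a *: x)] = series (`|a| *: (fun k => `|x k|)).
Proof. by congr series; apply/funext => k; rewrite /= normrM. Qed.

Fact ell1_submod_closed : submod_closed ell1_pred.
Proof.
split=> [|a x y /ell1_predP cx /ell1_predP cy]; apply/ell1_predP.
  exact: cvg_normed0.
apply: cvg_normedD cy; rewrite normed_seriesZ; exact: is_cvg_seriesZ.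
Qed.

HB.instance Definition _ :=
  GRing.isSubmodClosed.Build R (nat -> R) ell1_pred ell1_submod_closed.
HB.instance Definition _ := [SubChoice_isSubLmodule of ell1 by <:].

Lemma ell1_cvg (x : ell1) : cvgn [normed series x].
Proof. exact/ell1_predP/ell1_valP. Qed.
Arguments ell1_cvg : clear implicits.

Definition ell1_norm (x : ell1) : R := limn [normed series x].

Lemma ell1_normD (x y : ell1) : ell1_norm (x + y) <= ell1_norm x + ell1_norm y.
Proof.
rewrite /ell1_norm -(lim_seriesD (ell1_cvg x) (ell1_cvg y)).
apply: lim_series_le; first exact: ell1_cvg.
  by apply: is_cvg_seriesD; exact: ell1_cvg.
by move=> k; exact: ler_normD.
Qed.

Lemma ell1_normZ (a : R) (x : ell1) : ell1_norm (a *: x) = `|a| * ell1_norm x.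
Proof.
rewrite /ell1_norm -[RHS](lim_seriesZ `|a| (ell1_cvg x)).
by rewrite -normed_seriesZ.
Qed.

Lemma ell1_norm0_eq0 (x : ell1) : ell1_norm x = 0 -> x = 0.
Proof.
move=> x0; apply: val_inj; apply/funext => k /=.
have nd : nondecreasing_seq [normed series x].
  by apply/nondecreasing_seqP => n; rewrite !normed_seriesE big_nat_recr//= lerDl.
have := nondecreasing_cvgn_le nd (ell1_cvg x) k.+1.
rewrite -[limn _]/(ell1_norm x) x0 normed_seriesE big_nat_recr//= => h.
apply/eqP; rewrite -[eqbRHS]/(0 : R) -normr_le0.
by apply: le_trans h; rewrite lerDr sumr_ge0.
Qed.

HB.instance Definition _ :=
  Lmodule_isNormed.Build R ell1 ell1_normD ell1_normZ ell1_norm0_eq0.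

Definition shift_seq x : nat -> R := fun k => if k is m.+1 then x m else 0.

Lemma normed_series_shift x n :
  [normed series (shift_seq x)] n.+1 = [normed series x] n.
Proof. by rewrite !normed_seriesE big_nat_recl//= normr0 add0r. Qed.

Fact shift_subproof (x : ell1) : shift_seq x \in ell1_pred.
Proof.
apply/ell1_predP/(cvgP (limn [normed series x])); rewrite -cvg_shiftS.
rewrite [X in X @ _ --> _](_ : _ = [normed series x]); first exact: ell1_cvg.
by apply/funext => n; exact: normed_series_shift.
Qed.

Definition rshift_fun (x : ell1) : ell1 := Ell1 (shift_subproof x).

Fact rshift_linear : linear rshift_fun.
Proof.
move=> a x y; apply: val_inj; apply/funext => -[|k] //=.
by rewrite -[LHS]/(0 : R) -[RHS]/(a * 0 + 0) mulr0 addr0.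
Qed.

HB.instance Definition _ :=
  GRing.isLinear.Build R ell1 ell1 _ rshift_fun rshift_linear.

Definition right_shift : {linear ell1 -> ell1} := rshift_fun.

Definition e0_seq : nat -> R := fun k => (k == 0)%:R.

Lemma normed_series_e0 n : [normed series e0_seq] n.+1 = 1.
Proof.
rewrite normed_seriesE big_nat_recl//= /e0_seq normr1.
by rewrite big1 ?addr0// => i _; rewrite normr0.
Qed.

Fact e0_subproof : e0_seq \in ell1_pred.
Proof.
apply/ell1_predP; apply: (@cvgP _ _ (1 : R)); rewrite -cvg_shiftS.
rewrite [X in X @ _ --> _](_ : _ = cst 1); first exact: cvg_cst.
by apply/funext => n; exact: normed_series_e0.
Qed.

Definition ell1_e0 : ell1 := Ell1 e0_subproof.

End Ell1.

(* Main.v *)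
Require Import Defs.
From mathcomp Require Import all_boot all_order all_algebra.
From mathcomp Require Import all_classical all_reals all_analysis.
From mathcomp Require Import ring.
Import Order.TTheory GRing.Theory Num.Theory numFieldNormedType.Exports.
Local Open Scope classical_set_scope.
Local Open Scope ring_scope.

(** Since [T] is linear and [beta 0 = 0], unrolling the recursion writes the
    iterate [x_n] as the combination of [T^(n-k) y0], [0 <= k <= n], with
    weights [(1 - beta_k) * Pi_(k+1)^n] ([halpern_expansion]).  Subtracting
    its image under [T] takes differences of neighbouring weights: the residual
    [x_n - T x_n] becomes a combination of the [n + 2] vectors
    [y0, T y0, ..., T^(n+1) y0] ([halpern_residual]) whose coefficients have
    absolute values adding up to exactly [Theta_n] ([Theta_residual_coef]).

    Translating by a fixed point [p] of [T] changes [y0] into [y0 - p] and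
    leaves the residual unchanged, so one may expand around [p]; as a linear
    non-expansive map satisfies [|T^j z| <= |z|], the triangle inequality gives
    the bound.

    Both estimates are equalities for the right shift on l^1 started at [e_0]:
    it is an isometry, and the vectors [T^j e_0 = e_j] have disjoint supports,
    so the norm of a combination of them is the sum of the absolute values of
    the coefficients ([norm_shift_orbit]). *)

Section Expansion.
Context {R : realType}.
Implicit Types beta : nat -> R.

Lemma Pi_empty beta n : Pi beta n.+1 n = 1.
Proof. by rewrite /Pi big_geq. Qed.

Lemma Pi_recr beta k n : (k <= n.+1)%N ->
  Pi beta k n.+1 = Pi beta k n * beta n.+1.
Proof. by move=> kn; rewrite /Pi big_nat_recr. Qed.

Lemma Pi_recl beta k n : (k <= n)%N -> Pi beta k n = beta k * Pi beta k.+1 n.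
Proof. by move=> kn; rewrite /Pi big_ltn. Qed.

Lemma Pi_ge0 beta k n : (forall i, 0 <= beta i) -> 0 <= Pi beta k n.
Proof. by move=> b0; rewrite /Pi prodr_ge0. Qed.

(** The coefficient of [T^(n+1-k) y0] in [x_n - T x_n].  Counting [k] from the
    highest power of [T] matches the indexing of the sum in [Theta]; the two
    extreme powers [k = 0] and [k = n + 1] occur in only one of [T x_n] and
    [x_n]. *)
Definition residual_coef beta (n k : nat) : R :=
  if k == 0%N then - Pi beta 1 n
  else if k == n.+1 then 1 - beta n
  else ((2 - beta k.-1) * beta k - 1) * Pi beta k.+1 n.

(** [F] is arbitrary so that the same splitting serves the vector
    [x_n - T x_n] and the sum of the absolute values of its coefficients. *)
Lemma residual_coef_sum (V : nmodType) beta n (F : R -> nat -> V) :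
  \sum_(0 <= k < n.+2) F (residual_coef beta n k) k =
  F (- Pi beta 1 n) 0%N +
  \sum_(1 <= k < n.+1) F (((2 - beta k.-1) * beta k - 1) * Pi beta k.+1 n) k +
  F (1 - beta n) n.+1.
Proof.
rewrite big_ltn// big_nat_recr//= addrA /residual_coef/= eqxx.
congr (_ + _ + _); apply: eq_big_nat => k /andP[k0 kn].
by rewrite gtn_eqF// ltn_eqF.
Qed.

Lemma Theta_residual_coef beta n : (forall i, 0 <= beta i <= 1) ->
  Theta n beta = \sum_(0 <= k < n.+2) `|residual_coef beta n k|.
Proof.
move=> b01; have b0 i : 0 <= beta i by case/andP: (b01 i).
rewrite (residual_coef_sum _ _ _ (fun c _ => `|c|)) normrN ger0_norm ?Pi_ge0//.
rewrite [`|1 - _|]ger0_norm; last by rewrite subr_ge0; case/andP: (b01 n).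
rewrite /Theta [RHS]addrC addrA; congr (_ + _); apply: eq_bigr => k _.
by rewrite normrM [`|Pi _ _ _|]ger0_norm ?Pi_ge0.
Qed.

Variables (X : lmodType R) (T : {linear X -> X}) (beta : nat -> R).
Hypothesis beta0 : beta 0%N = 0.

(** Unrolling ends with [Pi_1^n * T^n x_0], where [x_0 = y0].  Since
    [1 - beta 0 = 1], this has the same form as the other terms, with [k = 0]. *)
Lemma halpern_expansion y0 n :
  halpern T beta y0 n =
  \sum_(0 <= k < n.+1) ((1 - beta k) * Pi beta k.+1 n) *: iter (n - k) T y0.
Proof.
elim: n => [|n IH]; first by rewrite big_nat1 beta0 Pi_empty subr0 mulr1 scale1r.
rewrite big_nat_recr//= Pi_empty mulr1 subnn addrC; congr (_ + _).
rewrite IH linear_sum scaler_sumr; apply: eq_big_nat => k /andP[_ kn].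
by rewrite linearZ scalerA subSn// Pi_recr// mulrC mulrA.
Qed.

Lemma halpern_residual y0 n :
  halpern T beta y0 n - T (halpern T beta y0 n) =
  \sum_(0 <= k < n.+2) residual_coef beta n k *: iter (n.+1 - k) T y0.
Proof.
rewrite (residual_coef_sum _ _ _ (fun c k => c *: iter (n.+1 - k) T y0)).
rewrite /= subnn halpern_expansion.
rewrite {1}big_nat_recr//= Pi_empty mulr1 subnn /=.
rewrite linear_sum [X in _ - X = _]big_ltn//= linearZ/= beta0 subr0 mul1r.
rewrite subn0 [LHS]addrAC; congr (_ + _); rewrite opprD addrCA scaleNr; congr (_ + _).
rewrite !big_add1/= -sumrB; apply: eq_big_nat => k /andP[_ kn].
(* Both weights are a multiple of the shorter product [Pi_(k+2)^n]. *)
rewrite linearZ/= -iterS subSS subnSK// -scalerBl; congr (_ *: _).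
by rewrite Pi_recl//; ring.
Qed.

Lemma halpern_subFix y0 p n : T p = p ->
  halpern T beta (y0 - p) n = halpern T beta y0 n - p.
Proof.
move=> Tp; elim: n => //= n ->; rewrite (linearB T) Tp !scalerBr.
by rewrite addrACA -opprD -scalerDl subrK scale1r.
Qed.

Lemma halpern_residual_subFix y0 p n : T p = p ->
  halpern T beta (y0 - p) n - T (halpern T beta (y0 - p) n) =
  halpern T beta y0 n - T (halpern T beta y0 n).
Proof.
by move=> Tp; rewrite halpern_subFix// (linearB T) Tp opprB addrA subrK.
Qed.

End Expansion.

Section UpperBound.
Context {R : realType}.
Variables (X : normedModType R) (T : {linear X -> X}).
Hypothesis Tne : nonexpansive T.

Lemma nonexpansive_norm_iter j z : `|iter j T z| <= `|z|.
Proof.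
elim: j => //= j; apply: le_trans.
by have := Tne (iter j T z) 0; rewrite linear0 !subr0.
Qed.

Lemma norm_residual_le (beta : nat -> R) y0 p n :
  (forall i, 0 <= beta i <= 1) -> beta 0%N = 0 -> T p = p ->
  `|halpern T beta y0 n - T (halpern T beta y0 n)| <= `|y0 - p| * Theta n beta.
Proof.
move=> b01 b0 Tp; rewrite -(halpern_residual_subFix _ _ _ _ _ _ Tp) halpern_residual//.
rewrite Theta_residual_coef// mulr_sumr (le_trans (ler_norm_sum _ _ _))//.
apply: ler_sum => k _; rewrite normrZ mulrC.
by apply: ler_wpM2r => //; exact: nonexpansive_norm_iter.
Qed.

End UpperBound.

Section Tightness.
Variable R : realType.
Local Notation S := (right_shift R).
Local Notation e0 := (ell1_e0 R).

(** The range of the shift consists of the sequences supported away from the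
    index [0], where alone [e0] lives, so the two norms add up. *)
Lemma norm_e0_shift (a : R) (x : ell1 R) : `|a *: e0 + S x| = `|a| + `|x|.
Proof.
have E n : [normed series (a *: e0 + S x : ell1 R)] n.+1 =
    `|a| + [normed series x] n.
  rewrite !normed_seriesE big_nat_recl//; congr (_ + _).
    by rewrite -[X in `|X|]/(a * 1 + 0) mulr1 addr0.
  apply: eq_bigr => k _.
  by rewrite -[X in `|X| = _]/(a * 0 + x k) mulr0 add0r.
apply: cvg_lim => //; rewrite -cvg_shiftS.
rewrite [X in X @ _ --> _](_ : _ = (fun n => `|a| + [normed series x] n)).
  by apply: cvgD; [exact: cvg_cst | exact: ell1_cvg].
exact/funext.
Qed.

Lemma norm_e0 : `|e0| = 1.
Proof.
by have := norm_e0_shift 1 0; rewrite linear0 scale1r addr0 normr0 addr0 normr1.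
Qed.

Lemma norm_shift x : `|S x| = `|x|.
Proof. by have := norm_e0_shift 0 x; rewrite scale0r normr0 !add0r. Qed.

Lemma nonexpansive_shift : nonexpansive S.
Proof. by move=> x y; rewrite -linearB norm_shift. Qed.

(** A fixed sequence starts with [0] and has equal consecutive terms. *)
Lemma Fix_shift : Fix S = [set 0].
Proof.
apply/seteqP; split => [x /= Sx|x /= ->]; last exact: linear0.
apply: val_inj; apply/funext => k /=.
have {}Sx j : S x j = x j by
  exact: (congr1 (fun y : ell1 R => y j) Sx).
by elim: k => [|k IH]; rewrite -Sx.
Qed.

(** In Horner form the sum is [c_n e_0 + S (...)], where the dots are a shorter
    sum of the same kind, so [norm_e0_shift] peels off one coefficient at a
    time. *)
Lemma norm_shift_orbit (c : nat -> R) n :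
  `|\sum_(0 <= k < n.+1) c k *: iter (n - k) S e0| =
  \sum_(0 <= k < n.+1) `|c k|.
Proof.
elim: n => [|n IH]; first by rewrite !big_nat1 normrZ norm_e0 mulr1.
rewrite big_nat_recr// [RHS]big_nat_recr//= -IH subnn/= addrC [RHS]addrC.
rewrite -norm_e0_shift linear_sum; congr `|_ + _|.
by apply: eq_big_nat => k /andP[_ kn]; rewrite linearZ subSn.
Qed.

End Tightness.

Theorem theorem4p4 (R : realType) (beta : nat -> R)
    (beta01 : forall n, 0 <= beta n <= 1) (beta0 : beta 0%N = 0) :
  (forall (X : normedModType R) (T : {linear X -> X}) (xstar y0 : X),
      nonexpansive T -> xstar \in Fix T ->
      let x := halpern T beta y0 in
      forall n, (1 <= n)%N ->
        `|x n - T (x n)| <= `|x 0%N - xstar| * Theta n beta)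
  /\
  (let T := right_shift R in
   let x := halpern T beta (ell1_e0 R) in
   [/\ nonexpansive T, Fix T = [set 0] &
    forall xstar, xstar \in Fix T -> forall n, (1 <= n)%N ->
        `|x n - T (x n)| = `|x 0%N - xstar| * Theta n beta]).
Proof.
split=> [X T p y0 Tne /set_mem Tp x n _|T x]; first exact: norm_residual_le.
split; [exact: nonexpansive_shift | exact: Fix_shift |].
move=> p; rewrite Fix_shift => /set_mem -> n _.
rewrite subr0 /x/= norm_e0 mul1r halpern_residual// norm_shift_orbit.
by rewrite Theta_residual_coef.
Qed.
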